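(* Let $n\ge 3$, let $a_1,\ldots,a_n,\kappa\in\mathbb{C}$ be arbitrary, and put \[ c_k=\kappa\,(a_{k+1}-a_1)(a_k-a_n),\qquad 1\le k\le n-1. \] Let $P_n(\lambda,t)$ be the spectral polynomial of the chain with diagonal $(a_1,\ldots,a_n)$ and squared couplings $(c_1,\ldots,c_{n-1})$. Then \[ P_n(\lambda,t)=\Bigl[(\lambda+a_1)(\lambda+a_n)+\kappa(a_1-a_n)^2\,t\Bigr]\,\widetilde P_{n-2}(\lambda,t), \] where $\widetilde P_{n-2}$ is the spectral polynomial of the chain with diagonal $(a_2,\ldots,a_{n-1})$ and squared couplings \[ \widetilde c_k=\kappa\,(a_{k+1}-a_1)(a_{k+2}-a_n),\qquad 1\le k\le n-3. \]
   Context: The spectral polynomial of the chain with diagonal $(\alpha_1,\ldots,\alpha_m)$ and squared couplings $(\gamma_1,\ldots,\gamma_{m-1})$ is the polynomial $p_m(\lambda,t)\in\mathbb{C}[\lambda,t]$ defined by $p_0=1$, $p_1=\lambda+\alpha_1$, $p_k=(\lambda+\alpha_k)p_{k-1}-t\,\gamma_{k-1}p_{k-2}$ for $2\le k\le m$. (Here $\gamma_k$ is the coupling joining the sites carrying $\alpha_k$ and $\alpha_{k+1}$.) *)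

(* Defs.v *)
From mathcomp Require Import all_boot all_order all_algebra.
From mathcomp Require Import reals complex.
From mathcomp Require Import mpoly.

Set Implicit Arguments.
Unset Strict Implicit.
Unset Printing Implicit Defensive.

Import GRing.Theory.
Local Open Scope ring_scope.

Definition lam (R : realType) : {mpoly R[i][2]} := 'X_(ord0 : 'I_2).
Definition tvar (R : realType) : {mpoly R[i][2]} := 'X_(ord_max : 'I_2).

(* The chain with diagonal (alpha 1, ..., alpha m) and squared couplings
   (gamma 1, ..., gamma m.-1); both families are indexed from 1, and their
   values at all other indices are never used. *)
Fixpoint spectral_poly (R : realType) (alpha gamma : nat -> R[i]) (m : nat) :
    {mpoly R[i][2]} :=
  match m with
  | 0 => 1
  | k'.+1 =>
    match k' with
    | 0 => lam R + (alpha 1%N)%:MP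
    | k.+1 => (lam R + (alpha k.+2)%:MP) * spectral_poly alpha gamma k'
              - tvar R * (gamma k.+1)%:MP * spectral_poly alpha gamma k
    end
  end.

(* Main.v *)
Require Import Defs.
From mathcomp Require Import all_boot all_order all_algebra.
From mathcomp Require Import reals complex.
From mathcomp Require Import mpoly ring.

(** Let [p_m] be the spectral polynomials of the chain with diagonal
[a_1, a_2, ...] and couplings [kappa (a_(k+1) - a_1) (a_k - b)], and [q_m] those
of the chain with diagonal [a_2, a_3, ...] and couplings
[kappa (a_(k+1) - a_1) (a_(k+2) - b)], where [b] stands for [a_n].  The idea is
to forget that [b] is the last diagonal entry.  For an arbitrary [b], the two
families satisfy

  [p_m = (lambda + a_1) q_(m-1) + kappa t (b - a_1) (a_m - a_1) q_(m-2)],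

which is proved by two-step induction from the three-term recurrences
([spectral_poly_interlace]).  For [m = n] and [b = a_n], the last coupling of
[q_(n-1)], which carries the factor [a_n - b], vanishes.  Hence
[q_(n-1) = (lambda + a_n) q_(n-2)], and [q_(n-2)] factors out of the relation. *)

Set Implicit Arguments.
Unset Strict Implicit.
Unset Printing Implicit Defensive.

Import GRing.Theory.
Local Open Scope ring_scope.

Lemma spectral_polySS (R : realType) (alpha gamma : nat -> R[i]) (m : nat) :
  spectral_poly alpha gamma m.+2 =
    (lam R + (alpha m.+2)%:MP) * spectral_poly alpha gamma m.+1
    - tvar R * (gamma m.+1)%:MP * spectral_poly alpha gamma m.
Proof. by []. Qed.

(** The parameter [b] is arbitrary here, which is what makes the induction on
the length of the chain possible. *)
Lemma spectral_poly_interlace (R : realType) (a : nat -> R[i])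
    (kappa b : R[i]) (m : nat) :
  let p := spectral_poly a (fun k => kappa * (a k.+1 - a 1%N) * (a k - b)) in
  let q := spectral_poly (fun k => a k.+1)
             (fun k => kappa * (a k.+1 - a 1%N) * (a k.+2 - b)) in
  p m.+2 = (lam R + (a 1%N)%:MP) * q m.+1
    + tvar R * (kappa * (b - a 1%N) * (a m.+2 - a 1%N))%:MP * q m.
Proof.
move=> p q.
suff [] : p m.+2 = (lam R + (a 1%N)%:MP) * q m.+1
    + tvar R * (kappa * (b - a 1%N) * (a m.+2 - a 1%N))%:MP * q m
  /\ p m.+3 = (lam R + (a 1%N)%:MP) * q m.+2
    + tvar R * (kappa * (b - a 1%N) * (a m.+3 - a 1%N))%:MP * q m.+1 by [].
elim: m => [|m [IH0 IH1]].
  by split; rewrite /p /q /= !(mpolyCM, mpolyCB); ring.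
split=> //.
rewrite [p m.+4]spectral_polySS -/p IH1 IH0 [q m.+3]spectral_polySS -/q.
(* [q m] enters only through [p m.+2], with a multiple of the coefficient that
   it has in the recurrence for [q m.+2]; unfolding [q m.+2] eliminates it. *)
rewrite [q m.+2]spectral_polySS -/q !(mpolyCM, mpolyCB).
by ring.
Qed.

Theorem theorem6p2 (R : realType) (n : nat) (a : nat -> R[i]) (kappa : R[i]) :
  (3 <= n)%N ->
  let c := fun k : nat => kappa * (a k.+1 - a 1%N) * (a k - a n) in
  let a' := fun k : nat => a k.+1 in
  let c' := fun k : nat => kappa * (a k.+1 - a 1%N) * (a k.+2 - a n) in
  spectral_poly a c n =
    ((lam R + (a 1%N)%:MP) * (lam R + (a n)%:MP)
     + (kappa * (a 1%N - a n) ^+ 2)%:MP * tvar R)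
    * spectral_poly a' c' (n - 2).
Proof.
case: n => [|[|[|n]]] // _ c a' c'.
rewrite [LHS]spectral_poly_interlace -/a' -/c' subSS subSS subn0.
rewrite spectral_polySS {2}/c' subrr mulr0 mpolyC0 /a'.
by rewrite !(mpolyCM, mpolyCB, rmorphXn, expr2); ring.
Qed.
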